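(* Let $(X,Y,c=\langle\cdot,\cdot\rangle)$ be a dual system, let $C\subset X$ be non-empty, and let $S\subset X\times Y$ be non-empty, dissipative, and convex. Let $\beta$ be a Hausdorff topology on $S$ such that $(S,\beta)$ is compact. Assume that, for every $x\in\operatorname{conv}C$, the map $S\ni(u,v)\mapsto\langle u-x,v\rangle$ is $\beta$-upper semicontinuous. Assume further that $$\forall x\in\operatorname{conv}C,\ \exists(u,v)\in S,\quad \langle u-x,v\rangle\ge0.$$ Then there exists $(a,b)\in S$ such that $$\forall x\in\operatorname{conv}C,\quad \langle a-x,b\rangle\ge0.$$
   Context: A dual system $(X,Y,c=\langle\cdot,\cdot\rangle)$ consists of real vector spaces $X,Y$ and a bilinear form $\langle\cdot,\cdot\rangle:X\times Y\to\mathbb{R}$; no separation is assumed. A set $S\subset X\times Y$ is dissipative if $\langle x_1-x_2,y_1-y_2\rangle\le0$ for all $(x_1,y_1),(x_2,y_2)\in S$. The topology $\beta$ is not assumed to be related to the linear structure. *)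

(* Defs.v *)
(* MathComp-Analysis: real vector spaces are lmodTypes over an arbitrary
   R : realType. *)
From HB Require Import structures.
From mathcomp Require Import all_boot all_order all_algebra.
From mathcomp Require Import all_classical all_reals all_analysis.

Set Implicit Arguments.
Unset Strict Implicit.
Unset Printing Implicit Defensive.

Import Order.TTheory GRing.Theory Num.Theory.
Import numFieldNormedType.Exports.

Local Open Scope classical_set_scope.
Local Open Scope ring_scope.

Definition dissipative (R : realType) (X Y : lmodType R)
    (c : {bilinear X -> Y -> R | *%R & *%R}) (S : set (X * Y)) : Prop :=
  forall p1 p2 : X * Y, S p1 -> S p2 -> c (p1.1 - p2.1) (p1.2 - p2.2) <= 0.

Definition conv_hull (R : realType) (X : lmodType R) (C : set X) : set X :=
  smallest (@convex_set R X) C.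

(* A topology as a first-class family of open sets, so that it can be
   quantified over on a given carrier. That set0 is open is open_bigcup over an
   empty index type. *)
Record topology_on (T : Type) := TopologyOn {
  open_in : set (set T) ;
  open_inT : open_in setT ;
  open_inI : forall A B : set T, open_in A -> open_in B -> open_in (A `&` B) ;
  open_in_bigcup : forall (I : Type) (A : I -> set T),
    (forall i, open_in (A i)) -> open_in (\bigcup_i A i)
}.

(* The pair (T, beta) as a topologicalType: the carrier is T itself, and the
   open sets are those of beta. *)
Definition with_topology (T : choiceType) (beta : topology_on T) : Type := T.

HB.instance Definition _ (T : choiceType) (beta : topology_on T) :=
  Choice.on (with_topology beta).
HB.instance Definition _ (T : choiceType) (beta : topology_on T) :=
  isOpenTopological.Build (with_topology beta)
    (open_inT beta) (@open_inI _ beta) (@open_in_bigcup _ beta).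

(* Real-valued dual of the library's lower_semicontinuous. *)
Definition upper_semicontinuous (R : realType) (T : topologicalType)
    (f : T -> R) : Prop :=
  forall (x : T) (a : R), f x < a ->
    exists2 V : set T, nbhs x V & forall y : T, V y -> f y < a.

(* Main.v *)
(* Dissipativity makes (u, v) |-> <u, v> concave on S, so (u, v) |-> <u - x, v>
   is concave on S and affine in x: the claim is a minimax theorem. Since beta
   is unrelated to the linear structure, convexity and compactness are used
   separately. Purely algebraically, if two concave functions have every convex
   combination nonnegative somewhere on S, then they are simultaneously
   >= -e somewhere on S, for all e > 0. Restricting S to the convex superlevel
   set of one function and iterating handles finitely many x. Compactness and
   upper semicontinuity then handle all x, and the limit e -> 0, at once. *)
Require Import Defs.
From HB Require Import structures.
From mathcomp Require Import all_boot all_order all_algebra.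
From mathcomp Require Import finmap all_classical all_reals all_analysis.
From mathcomp Require Import ring lra.

Set Implicit Arguments.
Unset Strict Implicit.
Unset Printing Implicit Defensive.

Import Order.TTheory GRing.Theory Num.Theory.
Import numFieldNormedType.Exports.

Local Open Scope classical_set_scope.
Local Open Scope ring_scope.

Lemma convex_set_mix (R : realType) (M : lmodType R) (A : set M) (x y : M)
    (t : R) : convex_set A -> A x -> A y -> 0 <= t -> t <= 1 ->
  A (t *: x + (1 - t) *: y).
Proof.
move=> cA Ax Ay t0 t1.
have := cA x y (Itv01 t0 t1) (mem_set Ax) (mem_set Ay).
by rewrite inE.
Qed.

Lemma convex_conv_hull (R : realType) (X : lmodType R) (C : set X) :
  convex_set (conv_hull C).
Proof.
move=> x y l; rewrite !inE => hx hy B [cB CB].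
exact: set_mem (cB x y l (mem_set (hx B (conj cB CB)))
  (mem_set (hy B (conj cB CB)))).
Qed.

Definition concave_on (R : realType) (M : lmodType R) (A : set M)
    (f : M -> R) : Prop :=
  forall (p q : M) (t : R), A p -> A q -> 0 <= t -> t <= 1 ->
    t * f p + (1 - t) * f q <= f (t *: p + (1 - t) *: q).

Section minimax.
Context (R : realType) (M : lmodType R).
Implicit Types (A : set M) (f g : M -> R).

Lemma concave_on_sub A B f : A `<=` B -> concave_on B f -> concave_on A f.
Proof. by move=> AB cf p q t /AB Bp /AB Bq; exact: cf. Qed.

Lemma convex_superlevel A f a : convex_set A -> concave_on A f ->
  convex_set (A `&` [set p | a <= f p]).
Proof.
move=> cA cf x y l; rewrite !inE => -[Ax fx] [Ay fy].
split; first exact: set_mem (cA x y l (mem_set Ax) (mem_set Ay)).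
have l0 : 0 <= l%:num by [].
have l1 : l%:num <= 1 by [].
apply: le_trans (cf _ _ _ Ax Ay l0 l1).
have l1' : 0 <= 1 - l%:num by lra.
have := lerD (ler_wpM2l l0 fx) (ler_wpM2l l1' fy); lra.
Qed.

Section two_functions.
Context (A : set M) (f g : M -> R) (e : R).
Hypotheses (cA : convex_set A) (cf : concave_on A f) (cg : concave_on A g).
Hypothesis e_gt0 : 0 < e.
Hypothesis mix_ge : forall t : R, 0 <= t -> t <= 1 ->
  exists2 p, A p & e <= t * f p + (1 - t) * g p.

(* Otherwise the combination of p and q at the zero of the chord of f would
   have both f >= 0 and g >= 0. *)
Let cross p q : (forall r, A r -> 0 <= f r -> g r < 0) ->
  A p -> A q -> 0 <= f p -> 0 <= g q -> f p * g q < g p * f q.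
Proof.
move=> fg Ap Aq fp gq.
have fq : f q < 0 by rewrite ltNge; apply/negP => /(fg q Aq); rewrite ltNge gq.
have d0 : 0 < f p - f q by lra.
pose t := - f q / (f p - f q).
have tE : t * (f p - f q) = - f q by rewrite /t divfK ?gt_eqF.
have t0 : 0 <= t by rewrite divr_ge0 ?ltW// oppr_gt0.
have t1 : t <= 1 by rewrite ler_pdivrMr// mul1r; lra.
have := fg _ (convex_set_mix cA Ap Aq t0 t1).
have := cf Ap Aq t0 t1.
rewrite (_ : t * f p + (1 - t) * f q = 0); last by lra.
move=> h /(_ h); move/(le_lt_trans (cg Ap Aq t0 t1)) => hg.
have : (t * g p + (1 - t) * g q) * (f p - f q) < 0 by rewrite pmulr_llt0.
have -> : (t * g p + (1 - t) * g q) * (f p - f q) =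
  t * (f p - f q) * g p + (f p - f q - t * (f p - f q)) * g q by ring.
by rewrite tE; lra.
Qed.

(** Planar separation: if it fails, [cross] puts each ratio [f p / - g p] with [0 <= f p] below each
    [- f q / g q] with [0 < g q], and a value between the two families contradicts [mix_ge]. *)
Lemma concave_both_ge0 : exists p, [/\ A p, 0 <= f p & 0 <= g p].
Proof.
apply: contrapT => nfg.
have fg p : A p -> 0 <= f p -> g p < 0.
  by move=> Ap fp; rewrite ltNge; apply/negP => gp; apply: nfg; exists p.
(* The extreme weights 1 and 0 give [p0], which makes the set [E] below nonempty, and [q0], where
   [g] is positive, which bounds it. *)
have [p0 Ap0] := mix_ge ler01 (lexx 1).
rewrite mul1r subrr mul0r addr0 => fp0.
have [q0 Aq0] := mix_ge (lexx 0) ler01.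
rewrite mul0r add0r subr0 mul1r => gq0.
pose E := [set f p / - g p | p in [set p | A p /\ 0 <= f p]].
have fp0_ge0 : 0 <= f p0 by exact: le_trans (ltW e_gt0) fp0.
have Ep0 : E (f p0 / - g p0) by exists p0.
have ubE q : A q -> 0 < g q -> ubound E (- f q / g q).
  move=> Aq gq _ [p [Ap fp] <-].
  have gp := fg p Ap fp.
  rewrite ler_pdivrMr ?oppr_gt0// mulrAC ler_pdivlMr// mulrNN [leRHS]mulrC.
  exact/ltW/cross/ltW.
have supE : has_sup E.
  by split; [exists (f p0 / - g p0)|exists (- f q0 / g q0); apply: ubE => //; exact: lt_le_trans gq0].
(* The line f + k * g = 0 separates the values of (f, g) on A from the
   positive quadrant. *)
pose k := sup E.
have k0 : 0 <= k.
  apply: le_trans (sup_upper_bound supE Ep0).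
  by rewrite divr_ge0// oppr_ge0 ltW// fg.
have fkg q : A q -> f q + k * g q <= 0.
  move=> Aq; have [fq|fq] := leP 0 (f q).
    have gq := fg q Aq fq.
    have : f q / - g q <= k by apply: (sup_upper_bound supE); exists q.
    by rewrite ler_pdivrMr ?oppr_gt0//; lra.
  have [gq|gq] := ltP 0 (g q); last by nra.
  have : k <= - f q / g q by apply: ge_sup; [exists (f p0 / - g p0)|exact: ubE].
  by rewrite ler_pdivlMr//; lra.
have k1 : 0 < 1 + k by lra.
(* This weight rescales [f + k * g] to a convex combination of [f] and [g]. *)
have t0 : 0 <= (1 + k)^-1 by rewrite invr_ge0 ltW.
have t1 : (1 + k)^-1 <= 1 by rewrite invf_le1//; lra.
have [p Ap] := mix_ge t0 t1.
have -> : (1 + k)^-1 * f p + (1 - (1 + k)^-1) * g p = (f p + k * g p) / (1 + k).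
  by field; rewrite gt_eqF.
rewrite ler_pdivlMr// => /(lt_le_trans (mulr_gt0 e_gt0 k1)).
by rewrite ltNge fkg.
Qed.

End two_functions.

Lemma concave_on_shift A f a : concave_on A f -> concave_on A (fun p => f p - a).
Proof. by move=> cf p q t Ap Aq t0 t1; have := cf p q t Ap Aq t0 t1 => /=; lra. Qed.

(** Subtracting [a - e] from both functions leaves the positive margin [e] that [concave_both_ge0]
    requires. *)
Lemma concave_both_ge A f g (a e : R) : convex_set A ->
  concave_on A f -> concave_on A g -> 0 < e ->
  (forall t : R, 0 <= t -> t <= 1 ->
    exists2 p, A p & a <= t * f p + (1 - t) * g p) ->
  exists p, [/\ A p, a - e <= f p & a - e <= g p].
Proof.
move=> cA cf cg e0 mix.
have [|p [Ap fp gp]] := @concave_both_ge0 A (fun p => f p - (a - e))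
    (fun p => g p - (a - e)) e cA (concave_on_shift _ cf)
    (concave_on_shift _ cg) e0.
  by move=> t t0 t1; have [p Ap hp] := mix t t0 t1; exists p => //; lra.
by exists p; split => //; lra.
Qed.

Context (X : lmodType R) (D : set X) (F : X -> M -> R).
Hypothesis cD : convex_set D.
Hypothesis affF : forall x y t p,
  F (t *: x + (1 - t) *: y) p = t * F x p + (1 - t) * F y p.

Lemma finite_minimax A (s : seq X) (a e : R) :
  A !=set0 -> convex_set A -> (forall x, D x -> concave_on A (F x)) ->
  (forall x, D x -> exists2 p, A p & a <= F x p) -> 0 < e ->
  (forall x, x \in s -> D x) ->
  exists2 p, A p & forall x, x \in s -> a - e <= F x p.
Proof.
elim: s A a e => [|x0 s IH] A a e A0 cA cF max_ge e0 sD.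
  by have [p Ap] := A0; exists p.
have Dx0 : D x0 by apply: sD; rewrite mem_head.
have e2 : 0 < e / 2 by rewrite divr_gt0.
pose B := A `&` [set p | a - e / 2 <= F x0 p].
(* A mixture of [F x] and [F x0] is [F] at a point of [D], so [max_ge] applies to it. The hypothesis
   thus survives on [B] at the cost of [e / 2]; the other half is left for the tail. *)
have max_geB x : D x -> exists2 p, B p & a - e / 2 <= F x p.
  move=> Dx; have [|p [Ap xp x0p]] :=
      concave_both_ge (a := a) cA (cF _ Dx) (cF _ Dx0) e2.
    move=> t t0 t1; have [p Ap hp] := max_ge _ (convex_set_mix cD Dx Dx0 t0 t1).
    by exists p => //; rewrite -affF.
  by exists p.
have [|||x xs|p [Ap x0p] sp] := IH B (a - e / 2) (e / 2) _ _ _ max_geB e2.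
- by have [p Bp _] := max_geB _ Dx0; exists p.
- exact: convex_superlevel (cF _ Dx0).
- by move=> x Dx; apply: concave_on_sub (cF _ Dx) => p [].
- by apply: sD; rewrite in_cons xs orbT.
exists p => // x; rewrite in_cons => /orP[/eqP->|/sp]; first by move: x0p => /=; lra.
by lra.
Qed.

End minimax.

(** The superlevel sets, indexed by the point and the error together, have the finite intersection
    property; a cluster point of the filter they generate is the required point. *)
Lemma compact_usc_common_ge0 (R : realType) (T : topologicalType)
    (X : choiceType) (D : set X) (G : X -> T -> R) :
  compact [set: T] -> (forall x, D x -> upper_semicontinuous (G x)) ->
  (forall (s : seq X) (e : R), 0 < e -> (forall x, x \in s -> D x) ->
    exists p, forall x, x \in s -> - e <= G x p) ->
  exists p, forall x, D x -> 0 <= G x p.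
Proof.
move=> cT usc fin.
pose I := [set i : X * R | D i.1 /\ 0 < i.2].
pose L (i : X * R) := [set p | - i.2 <= G i.1 p].
have finL : finI I L.
  move=> J JI.
  have [e e0 eJ] : exists2 e : R, 0 < e & forall i, i \in J -> e <= i.2.
    (* Starting the minimum at 1 keeps it positive even for empty [J]. *)
    exists (\big[Num.min/1]_(i <- J) i.2).
      rewrite big_seq; elim/big_ind: _ => // [x y x0 y0|i iJ].
        by rewrite lt_min x0.
      by have := JI _ iJ; rewrite inE => -[].
    by move=> i iJ; apply: ge_bigmin_seq.
  have [x /mapP[i /JI + ->]|p pJ] := fin [seq i.1 | i <- J] e e0.
    by rewrite inE => -[].
  exists p => i iJ; rewrite /L/=; apply: le_trans (pJ _ (map_f _ iJ)).
  by rewrite lerN2 eJ.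
have FF := finI_filter finL.
have [p [_ clp]] := cT _ FF filterT.
exists p => x Dx; rewrite leNgt; apply/negP => xp.
(* Near [p], [G x] stays below this threshold, whereas [L] with error [- (G x p / 2)] forces it
   above. *)
have xp2 : G x p < G x p / 2 by lra.
have [V pV xV] := usc x Dx p _ xp2.
have xI : I (x, - (G x p / 2)) by split => //=; lra.
have FL : filter_from (finI_from I L) id (L (x, - (G x p / 2))).
  by exists (L (x, - (G x p / 2))) => //; exact: finI_from1.
have [y [xy Vy]] := clp _ V FL pV.
by move: xy (xV y Vy); rewrite /L/= opprK leNgt => /negP.
Qed.

Section dual_system.
Context (R : realType) (X Y : lmodType R) (c : {bilinear X -> Y -> R | *%R & *%R}).

Lemma pairing_affine (x y : X) (t : R) (p : X * Y) :
  c (p.1 - (t *: x + (1 - t) *: y)) p.2 =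
  t * c (p.1 - x) p.2 + (1 - t) * c (p.1 - y) p.2.
Proof. by rewrite !linearBl linearDl !linearZl_LR/=; ring. Qed.

(** The concavity defect is exactly [- t * (1 - t) * c (p.1 - q.1) (p.2 - q.2)]; the term in [x] is
    linear and cancels. *)
Lemma dissipative_concave (S : set (X * Y)) (x : X) : dissipative c S ->
  concave_on S (fun p => c (p.1 - x) p.2).
Proof.
move=> dS p q t Sp Sq t0 t1; have := dS p q Sp Sq.
rewrite !(linearBl, linearDl, linearBr, linearDr, linearZl_LR, linearZr_LR)/=.
rewrite /GRing.scale/= => cpq.
have t1t : 0 <= t * (1 - t) by rewrite mulr_ge0// subr_ge0.
by have := mulr_ge0_le0 t1t cpq; lra.
Qed.

End dual_system.

Theorem corollary24 (R : realType) (X Y : lmodType R)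
    (c : {bilinear X -> Y -> R | *%R & *%R})
    (C : set X) (S : set (X * Y)) (beta : topology_on S) :
  C !=set0 ->
  S !=set0 ->
  dissipative c S ->
  convex_set S ->
  hausdorff_space (with_topology beta) ->
  compact [set: with_topology beta] ->
  (forall x : X, conv_hull C x ->
     upper_semicontinuous
       (fun p : with_topology beta => c ((set_val p).1 - x) (set_val p).2)) ->
  (forall x : X, conv_hull C x ->
     exists2 p : X * Y, S p & 0 <= c (p.1 - x) p.2) ->
  exists2 q : X * Y, S q &
    forall x : X, conv_hull C x -> 0 <= c (q.1 - x) q.2.
Proof.
move=> _ S0 dS cS _ compS usc max_ge.
have [|p pP] := @compact_usc_common_ge0 R (with_topology beta) X (conv_hull C)
    (fun x p => c ((set_val p).1 - x) (set_val p).2) compS usc.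
  move=> s e e0 sD.
  (* The algebraic minimax runs in [X * Y] with [a = 0]; its point is then repackaged in the carrier
     of [beta]. *)
  have [q Sq qs] := finite_minimax (@convex_conv_hull R X C)
    (pairing_affine c) S0 cS (fun x _ => dissipative_concave x dS) max_ge e0 sD.
  exists (SigSub (mem_set Sq)) => x xs.
  by have := qs x xs; rewrite sub0r.
by exists (set_val p) => //; exact: set_valP.
Qed.
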